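(* Let $d\ge 2$ and $1\le k\le d+1$ be integers, $\beta$ real, and $\mathbf{x}\in T_d(k,\beta)$. Suppose $R_d\cup\{\mathbf{x}\}$ has only two distances $\sqrt{2}$ and $\sqrt{\alpha}$. Then: (1) If $\alpha<2$ and $s\ge 2$ satisfy $\alpha/2=(s-1)/s$, then $2\le k\le d$, $k\ne s^2$, $\beta=-1/s$, and \[ d=k+s^2-2s-1+\frac{s^2(s-1)^2}{k-s^2}. \] (2) If $\alpha>2$ and $s\ge 2$ satisfy $2/\alpha=(s-1)/s$, then $2\le k\le d$, $d+2\ge k+s$, $k\ne (s-1)^2$, $\beta=1/(s-1)$, and \[ d=k+s^2-2+\frac{s^2(s-1)^2}{k-(s-1)^2}. \]
   Context: For an integer $d\ge 2$, let $H_d=\{(x_1,\dots,x_{d+1})\in\mathbb{R}^{d+1}:\sum_i x_i=1\}$ with the Euclidean distance, and let $R_d=\{\mathbf{e}_1,\dots,\mathbf{e}_{d+1}\}$ be the standard basis vectors of $\mathbb{R}^{d+1}$ (a regular simplex in $H_d$ with all distances $\sqrt2$). For an integer $1\le k\le d+1$ and real $\beta$, put $c=(1-(d+1-k)\beta)/(d+1)$ and $T_d(k,\beta)=\{\mathbf{x}\in H_d: x_i\in\{c,c+\beta\}\text{ for all }i,\ |\{i:x_i=c\}|=k\}$. (The number $s$ is the LRS ratio: for a two-distance set with distances $a<b$, $a^2/b^2=(s-1)/s$.)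
   Formalization: As T_d(k,β)=T_d(d+1−k,−β) for β≠0 and k≤d, the literal claim fails (d=8, k=4, β=1/2, s=2); the conclusions are proved for whichever of (k,β), (d+1−k,−β) has x_i=c exactly when e_i is at distance √α from x. *)

(* Defs.v *)
From HB Require Import structures.
From mathcomp Require Import all_boot all_order all_algebra.
From mathcomp Require Import classical_sets reals.
Set Implicit Arguments.
Unset Strict Implicit.
Unset Printing Implicit Defensive.
Import Order.TTheory GRing.Theory Num.Theory.
Local Open Scope ring_scope.
Local Open Scope classical_set_scope.

Definition edist (R : realType) (n : nat) (x y : 'rV[R]_n) : R :=
  Num.sqrt (\sum_(i < n) (x 0 i - y 0 i) ^+ 2).

Definition distances (R : realType) (n : nat) (A : set 'rV[R]_n) : set R :=
  [set r | exists x y, [/\ A x, A y, x <> y & r = edist x y]].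

(* Both values must occur: a set with a single distance does not qualify. *)
Definition has_two_distances (R : realType) (n : nat) (A : set 'rV[R]_n)
    (a b : R) : Prop :=
  a <> b /\ distances A = [set a; b].

Definition Hd (R : realType) (d : nat) : set 'rV[R]_d.+1 :=
  [set x | \sum_(i < d.+1) x 0 i = 1].

Definition Rd (R : realType) (d : nat) : set 'rV[R]_d.+1 :=
  [set x | exists i : 'I_d.+1, x = delta_mx 0 i].
Arguments Rd R d : clear implicits.

Definition cd (R : realType) (d k : nat) (beta : R) : R :=
  (1 - (d.+1%:R - k%:R) * beta) / d.+1%:R.
Arguments cd {R} d k beta.

(* For beta != 0, Td d k beta = Td d (d.+1 - k) (- beta): the two coordinate   *)
(* values c and c + beta exchange roles.                                       *)
Definition Td (R : realType) (d k : nat) (beta : R) : set 'rV[R]_d.+1 :=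
  [set x | [/\ Hd x,
               forall i, x 0 i = cd d k beta \/ x 0 i = cd d k beta + beta
             & #|[pred i : 'I_d.+1 | x 0 i == cd d k beta]| = k]].
Arguments Td {R} d k beta.

(* Main.v *)
Require Import Defs.
From HB Require Import structures.
From mathcomp Require Import all_boot all_order all_algebra.
From mathcomp Require Import classical_sets reals.
From mathcomp Require Import ring lra.
Set Implicit Arguments.
Unset Strict Implicit.
Unset Printing Implicit Defensive.
Import Order.TTheory GRing.Theory Num.Theory.
Local Open Scope ring_scope.
Local Open Scope classical_set_scope.

(** Since [|x - e_i|^2 = |x|^2 - 2 x_i + 1], the coordinate [x_i] determines the
    distance from [x] to [e_i]; after exchanging the two coordinate values if
    necessary, [x_i = c] when this distance is [sqrt alpha].  Subtracting the
    two squared distances gives [alpha = 2 + 2 beta], and computing [|x|^2] from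
    [k] and [beta] gives [(d + 1) (k beta^2 - 1) = (1 + k beta)^2].  Both cases
    then follow by the same calculation: with [t = s] if [alpha < 2] and
    [t = 1 - s] if [alpha > 2], one has [beta = - 1 / t], so that
    [(d + 1) (k - t^2) = (k - t)^2].  The right-hand side is positive, hence
    [k > t^2 >= 1], and one can solve for [d]. *)

Section Distances.
Variables (R : realType) (n : nat).
Implicit Types (A : set 'rV[R]_n) (x y : 'rV[R]_n) (a b : R).

Lemma edistC x y : edist x y = edist y x.
Proof. by congr Num.sqrt; apply: eq_bigr => i _; rewrite -sqrrN opprB. Qed.

Lemma sqr_edist x y : edist x y ^+ 2 = \sum_(i < n) (x 0 i - y 0 i) ^+ 2.
Proof. by rewrite sqr_sqrtr // sumr_ge0 // => i _; apply: sqr_ge0. Qed.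

Lemma distances_setU1 A x :
  distances (A `|` [set x]) = distances A `|` [set edist x y | y in A `\ x].
Proof.
apply/seteqP; split=> r /=.
- move=> [u [v [[Au|->] [Av|->] uv ->]]] //.
  + by left; exists u, v.
  + by right; exists u; rewrite // edistC.
  + by right; exists v => //; split=> // /esym.
- move=> [[u [v [Au Av uv ->]]]|[y [Ay xy] <-]].
  + by exists u, v; split=> //; left.
  + by exists x, y; split=> //; [right|left|move/esym].
Qed.

Lemma has_two_distances_setU1 A x a b :
    distances A `<=` [set a] -> has_two_distances (A `|` [set x]) a b ->
  (exists2 y, A y & edist x y = b) /\
  forall y, A y -> edist x y = a \/ edist x y = b.
Proof.
move=> dA [ab dAx].
have notdAb : ~ distances A b by move/dA/esym.
have notAx : ~ A x.
  move=> Ax; apply: notdAb; rewrite -[A](@setUidl _ _ [set x]) => [|_ -> //].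
  by rewrite dAx; right.
move: dAx; rewrite distances_setU1 => dAx; split=> [|y Ay].
  have : (distances A `|` [set edist x y | y in A `\ x]) b.
    by rewrite dAx; right.
  by case=> // -[y [Ay _] <-]; exists y.
suff : [set a; b] (edist x y) by [].
rewrite -dAx; right; exists y => //; split=> // yx.
by apply: notAx; rewrite -yx.
Qed.

Lemma sqr_edist_delta x (i : 'I_n) :
  edist x (delta_mx 0 i) ^+ 2 = \sum_(j < n) x 0 j ^+ 2 - 2 * x 0 i + 1.
Proof.
rewrite sqr_edist (bigD1 i) //= [in RHS](bigD1 i) //= mxE !eqxx /=.
rewrite (eq_bigr (fun j => x 0 j ^+ 2)) => [|j ji]; first by ring.
by rewrite mxE (negbTE ji) andbF subr0.
Qed.

Lemma eq_edist_delta x (i j : 'I_n) :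
  (edist x (delta_mx 0 i) == edist x (delta_mx 0 j)) = (x 0 i == x 0 j).
Proof.
rewrite -(eqrXn2 (n := 2)) ?sqrtr_ge0 // !sqr_edist_delta.
by apply/eqP/eqP => [|->]; first by lra.
Qed.

Lemma edist_delta_delta (i j : 'I_n) :
  i != j -> edist (delta_mx 0 i : 'rV[R]_n) (delta_mx 0 j) = Num.sqrt 2.
Proof.
move=> ij; apply/eqP; rewrite -(eqrXn2 (n := 2)) ?sqrtr_ge0 //.
rewrite sqr_edist_delta sqr_sqrtr // (bigD1 i) //= big1 => [|l li].
  by rewrite !mxE !eqxx [j == i]eq_sym (negbTE ij) /=; apply/eqP; ring.
by rewrite mxE (negbTE li) andbF expr0n.
Qed.

End Distances.

Lemma distances_Rd (R : realType) d :
  distances (Rd R d) `<=` [set Num.sqrt 2].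
Proof.
move=> _ [_ [_ [[i ->] [j ->] ij ->]]]; apply: edist_delta_delta.
by apply/eqP => eij; apply: ij; rewrite eij.
Qed.

Lemma has_two_distances_RdU1 (R : realType) d (x : 'rV[R]_d.+1) (b : R) :
    has_two_distances (Rd R d `|` [set x]) (Num.sqrt 2) b ->
  (exists i, edist x (delta_mx 0 i) = b) /\
  forall i, edist x (delta_mx 0 i) = Num.sqrt 2 \/ edist x (delta_mx 0 i) = b.
Proof.
move=> /(has_two_distances_setU1 (@distances_Rd R d))[[_ [i ->] ei] two].
by split=> [|j]; [exists i|apply: two; exists j].
Qed.

Section CoordinateValues.
Variables (R : realType) (d : nat).
Implicit Types (k : nat) (beta : R) (x : 'rV[R]_d.+1) (i : 'I_d.+1).

Lemma mulr_cd k beta :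
  d.+1%:R * cd d k beta = 1 - (d.+1%:R - k%:R) * beta.
Proof. by rewrite /cd mulrCA divff ?mulr1 ?pnatr_eq0. Qed.

Lemma cd_swap k beta : (k <= d.+1)%N ->
  cd d (d.+1 - k) (- beta) = cd d k beta + beta.
Proof.
move=> kd; have n0 : d.+1%:R != 0 :> R by rewrite pnatr_eq0.
by apply: (mulfI n0); rewrite mulrDr !mulr_cd natrB //; ring.
Qed.

Lemma Td_leq k beta x : Td d k beta x -> (k <= d.+1)%N.
Proof. by case=> _ _ <-; rewrite -[leqRHS]card_ord max_card. Qed.

Lemma Td_gt0 k beta x i : Td d k beta x -> x 0 i = cd d k beta -> (0 < k)%N.
Proof.
by case=> _ _ card xi; rewrite -card; apply/card_gt0P; exists i; apply/eqP.
Qed.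

Lemma Td_card_neq k beta x : Td d k beta x ->
  #|[pred i | x 0 i != cd d k beta]| = (d.+1 - k)%N.
Proof.
case=> _ _ card; rewrite -[d.+1 in RHS]card_ord.
by rewrite -(cardC [pred i | x 0 i == cd d k beta]) card addKn.
Qed.

Lemma Td_ltnP k beta x : Td d k beta x ->
  reflect (exists i, x 0 i != cd d k beta) (k < d.+1)%N.
Proof.
by move=> Tx; rewrite -subn_gt0 -(Td_card_neq Tx); apply: card_gt0P.
Qed.

Lemma Td_neq k beta x i : Td d k beta x ->
  x 0 i != cd d k beta -> x 0 i = cd d k beta + beta.
Proof. by case=> _ val _ /eqP xi; case: (val i). Qed.

Lemma Td_swap k beta x : beta != 0 ->
  Td d k beta x -> Td d (d.+1 - k) (- beta) x.
Proof.
move=> b0 Tx; have [hx val _] := Tx.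
split; rewrite ?(cd_swap _ (Td_leq Tx)) ?addrK //.
  by move=> i; case: (val i); [right|left].
rewrite -(Td_card_neq Tx); apply: eq_card => i; rewrite !inE.
apply/idP/idP => [/eqP ->|/(Td_neq Tx) -> //].
by rewrite -subr_eq0 addrAC subrr add0r.
Qed.

Lemma Td_relabel k beta x i : Td d k beta x ->
  exists (k' : nat) (beta' : R),
    [/\ (k' = k /\ beta' = beta) \/ (k' = (d.+1 - k)%N /\ beta' = - beta),
        Td d k' beta' x & x 0 i = cd d k' beta'].
Proof.
move=> Tx; have [xi|xi] := eqVneq (x 0 i) (cd d k beta).
  by exists k, beta; split=> //; left.
have xiE := Td_neq Tx xi.
have b0 : beta != 0 by apply: contraNneq xi => b0; rewrite xiE b0 addr0.
exists (d.+1 - k)%N, (- beta); split; [by right|exact: Td_swap|].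
by rewrite cd_swap ?(Td_leq Tx).
Qed.

Lemma sum_Td (V : nmodType) (f : R -> V) k beta x : Td d k beta x ->
  \sum_i f (x 0 i) =
  f (cd d k beta) *+ k + f (cd d k beta + beta) *+ (d.+1 - k).
Proof.
move=> Tx; have [_ _ card] := Tx.
rewrite (bigID (fun i => x 0 i == cd d k beta)) /=; congr (_ + _).
  rewrite (eq_bigr (fun=> f (cd d k beta))) => [|i /eqP -> //].
  by rewrite sumr_const card.
rewrite (eq_bigr (fun=> f (cd d k beta + beta))) => [|i].
  by rewrite sumr_const (Td_card_neq Tx).
by move/(Td_neq Tx) ->.
Qed.

Lemma sqr_norm_Td k beta x : Td d k beta x ->
  d.+1%:R * (\sum_i x 0 i ^+ 2) = 1 + k%:R * (d.+1%:R - k%:R) * beta ^+ 2.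
Proof.
move=> Tx; rewrite (sum_Td (fun y => y ^+ 2) Tx).
rewrite -[_ *+ k]mulr_natl -[_ *+ (_ - _)]mulr_natl natrB ?(Td_leq Tx) //.
have n0 : d.+1%:R != 0 :> R by rewrite pnatr_eq0.
by rewrite /cd; move: d.+1%:R n0 => n n0; field.
Qed.

Lemma sqr_edist_Td k beta x i : Td d k beta x ->
  d.+1%:R * edist x (delta_mx 0 i) ^+ 2 =
  d.+1%:R * (1 - 2 * x 0 i) + 1 + k%:R * (d.+1%:R - k%:R) * beta ^+ 2.
Proof.
by move=> Tx; rewrite sqr_edist_delta !mulrDr (sqr_norm_Td Tx); ring.
Qed.

(* For [k = d + 1] the point [x] is the centroid, at squared distance
   [d / (d + 1)] from every vertex. *)
Lemma Td_edist_ltn k beta x i : Td d k beta x ->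
  x 0 i = cd d k beta -> 1 <= edist x (delta_mx 0 i) ^+ 2 -> (k < d.+1)%N.
Proof.
move=> Tx xi e1; rewrite ltn_neqAle (Td_leq Tx) andbT.
apply/eqP => kE; have := sqr_edist_Td i Tx; have := mulr_cd k beta.
have : d.+1%:R <= d.+1%:R * edist x (delta_mx 0 i) ^+ 2 by rewrite ler_peMr.
by rewrite xi kE subrr; lra.
Qed.

Lemma Td_sqrt2_equation k beta x j : Td d k beta x ->
    x 0 j = cd d k beta + beta -> edist x (delta_mx 0 j) = Num.sqrt 2 ->
  d.+1%:R * (k%:R * beta ^+ 2 - 1) = (1 + k%:R * beta) ^+ 2.
Proof.
move=> Tx xj ej; have := sqr_edist_Td j Tx; have := mulr_cd k beta.
by rewrite ej sqr_sqrtr // xj; lra.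
Qed.

End CoordinateValues.

Lemma ratio_equation (F : fieldType) (n k t : F) : t != 0 ->
  n * (k * (- t^-1) ^+ 2 - 1) = (1 + k * - t^-1) ^+ 2 ->
  n * (k - t ^+ 2) = (k - t) ^+ 2.
Proof.
move=> t0 dim_eq.
have -> : (k - t) ^+ 2 = t ^+ 2 * (1 + k * - t^-1) ^+ 2 by field.
by rewrite -dim_eq; field.
Qed.

Section RatioEquation.
Variables (F : realFieldType) (n k t : F).
Hypotheses (n_gt0 : 0 < n) (t_notin01 : t < 0 \/ 1 < t).
Hypothesis ratio_eq : n * (k - t ^+ 2) = (k - t) ^+ 2.

Lemma ratio_equation_sqr_lt : t ^+ 2 < k.
Proof.
rewrite -subr_gt0 -(pmulr_rgt0 _ n_gt0) ratio_eq exprn_even_gt0 //= subr_eq0.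
apply/eqP => kt; move: ratio_eq; rewrite kt subrr expr0n /=.
by move/eqP; rewrite mulf_eq0 gt_eqF //= => /eqP; case: t_notin01; nra.
Qed.

Lemma ratio_equation_sub_le : k - t <= n.
Proof.
have kt2 := ratio_equation_sqr_lt.
have t_lt_sqr : t < t ^+ 2 by case: t_notin01; nra.
by rewrite -(@ler_pM2r _ (k - t ^+ 2)) ?subr_gt0 // ratio_eq; nra.
Qed.

Lemma ratio_equation_solve :
  n = k + t ^+ 2 - 2 * t + t ^+ 2 * (t - 1) ^+ 2 / (k - t ^+ 2).
Proof.
have kt2 : k - t ^+ 2 != 0 by rewrite subr_eq0 gt_eqF // ratio_equation_sqr_lt.
by apply: (mulIf kt2); rewrite ratio_eq; field.
Qed.

End RatioEquation.

Section TwoDistances.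
Variables (R : realType) (d k : nat) (beta alpha : R).
Variables (x : 'rV[R]_d.+1) (i : 'I_d.+1).
Hypothesis two_dist :
  has_two_distances (Rd R d `|` [set x]) (Num.sqrt 2) (Num.sqrt alpha).
Hypotheses (Tx : Td d k beta x) (xi : x 0 i = cd d k beta).
Hypothesis ei : edist x (delta_mx 0 i) = Num.sqrt alpha.

Lemma Td_two_distances : 1 <= alpha ->
  [/\ (k <= d)%N, alpha = 2 + 2 * beta &
      d.+1%:R * (k%:R * beta ^+ 2 - 1) = (1 + k%:R * beta) ^+ 2].
Proof.
move=> alpha1.
have sqr_ei : edist x (delta_mx 0 i) ^+ 2 = alpha by rewrite ei sqr_sqrtr; lra.
have kd : (k < d.+1)%N by apply: (Td_edist_ltn Tx xi); rewrite sqr_ei.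
have [j xj] := Td_ltnP Tx kd.
have xjE := Td_neq Tx xj.
have ej : edist x (delta_mx 0 j) = Num.sqrt 2.
  have [_ /(_ j)[//|/eqP]] := has_two_distances_RdU1 two_dist.
  by rewrite -ei eq_edist_delta xi (negbTE xj).
split=> //; last exact: Td_sqrt2_equation xjE ej.
have := sqr_edist_delta x j; rewrite ej sqr_sqrtr // xjE.
by have := sqr_edist_delta x i; rewrite sqr_ei xi; lra.
Qed.

Lemma Td_two_distances_ratio (t : R) :
    t <= -1 \/ 2 <= t -> alpha / 2 = (t - 1) / t ->
  [/\ (2 <= k <= d)%N, t ^+ 2 < k%:R, k%:R - t <= d%:R + 1, beta = - t^-1 &
      d%:R = k%:R + t ^+ 2 - 2 * t - 1
             + t ^+ 2 * (t - 1) ^+ 2 / (k%:R - t ^+ 2)].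
Proof.
move=> t_out half_alphaE.
have t0 : t != 0 by apply/eqP; case: t_out; lra.
have alphaE : alpha = 2 - 2 * t^-1.
  by rewrite -[alpha](@divfK _ 2) ?pnatr_eq0 // half_alphaE; field.
have tV_le : t^-1 <= 1 / 2.
  case: t_out => t_bound; last by rewrite div1r lef_pV2 // posrE; lra.
  by have : t^-1 < 0 by [rewrite invr_lt0; lra]; lra.
have [|kd alpha_beta dim_eq] := Td_two_distances; first lra.
have betaE : beta = - t^-1 by lra.
have ratio_eq : d.+1%:R * (k%:R - t ^+ 2) = (k%:R - t) ^+ 2.
  by apply: ratio_equation => //; rewrite -betaE.
have n_gt0 : 0 < d.+1%:R :> R by rewrite ltr0n.
have t_notin01 : t < 0 \/ 1 < t by case: t_out; [left|right]; lra.
have t2_lt_k := ratio_equation_sqr_lt n_gt0 t_notin01 ratio_eq.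
split=> //.
- rewrite kd andbT -(ltr1n R) (le_lt_trans _ t2_lt_k) //.
  by case: t_out; nra.
- by rewrite natr1 ratio_equation_sub_le.
- by have := ratio_equation_solve n_gt0 t_notin01 ratio_eq; rewrite -natr1; lra.
Qed.

End TwoDistances.

(* [(k, beta)] and [(d.+1 - k, - beta)] may describe the same point [x]; the
   claim holds for one of the two descriptions only. *)
Theorem theorem3p1 (R : realType) (d k : nat) (beta alpha : R)
    (x : 'rV[R]_d.+1)
    (hd : (2 <= d)%N) (hk : (1 <= k <= d.+1)%N)
    (hx : Td d k beta x)
    (h2 : has_two_distances (Rd R d `|` [set x])
            (Num.sqrt 2) (Num.sqrt alpha)) :
  exists (k' : nat) (beta' : R),
    [/\ (k' = k /\ beta' = beta) \/ (k' = (d.+1 - k)%N /\ beta' = - beta),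
        (1 <= k' <= d.+1)%N /\ Td d k' beta' x,
        forall i : 'I_d.+1,
          x 0 i = cd d k' beta' <->
          edist x (delta_mx 0 i) = Num.sqrt alpha,
        forall s : R, alpha < 2 -> 2 <= s -> alpha / 2 = (s - 1) / s ->
          [/\ (2 <= k' <= d)%N, k'%:R <> s ^+ 2, beta' = - (1 / s)
            & d%:R = k'%:R + s ^+ 2 - 2 * s - 1
                     + s ^+ 2 * (s - 1) ^+ 2 / (k'%:R - s ^+ 2)]
      & forall s : R, 2 < alpha -> 2 <= s -> 2 / alpha = (s - 1) / s ->
          [/\ (2 <= k' <= d)%N, k'%:R + s <= d%:R + 2,
              k'%:R <> (s - 1) ^+ 2, beta' = 1 / (s - 1)
            & d%:R = k'%:R + s ^+ 2 - 2
                     + s ^+ 2 * (s - 1) ^+ 2 / (k'%:R - (s - 1) ^+ 2)]].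
Proof.
have [[i ei] _] := has_two_distances_RdU1 h2.
have [k' [beta' [rel Tx xi]]] := Td_relabel i hx.
have ratio := Td_two_distances_ratio h2 Tx xi ei.
exists k', beta'; split=> //.
- by rewrite (Td_gt0 Tx xi) (Td_leq Tx).
- move=> j; rewrite -xi -ei.
  by split=> /eqP; [rewrite -eq_edist_delta|rewrite eq_edist_delta]; move/eqP.
- move=> s _ s2 alphaE.
  have [|//|k2d ks _ betaE dE] := ratio s; first by right.
  by split; rewrite ?div1r //; apply/eqP; rewrite gt_eqF.
- move=> s alpha2 s2 alphaE.
  have alphaE' : alpha / 2 = (1 - s - 1) / (1 - s).
    rewrite -[LHS]invrK invf_div alphaE invf_div.
    by field; rewrite ?subr_eq0; apply/andP; split; apply/eqP; lra.
  have [|//|k2d ks ksd betaE dE] := ratio (1 - s); first by left; lra.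
  have sqr_sC : (1 - s) ^+ 2 = (s - 1) ^+ 2 by rewrite -sqrrN opprB.
  rewrite sqr_sC in ks dE; split=> //.
  + lra.
  + by apply/eqP; rewrite gt_eqF.
  + by rewrite betaE -invrN opprB div1r.
  + by rewrite dE; ring.
Qed.
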